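(* Let $I$ be an almost complete intersection squarefree monomial ideal of $R=K[x_1,\ldots,x_n]$ with $\operatorname{height}(I)=q\ge 2$. Consider the following possible forms of $I$, where in each form the monomials $u_1,u_2,\ldots,v_1,v_2,\ldots$ that appear are squarefree, different from $1$, and no two of them have a common factor, and where $r$ is an integer with $2\le r\le q$: (i) $I=(u_1v_1,u_2v_2,\ldots,u_rv_r,u_{r+1},\ldots,u_q,v_1v_2\cdots v_r)$; (ii) $I=(u_1v_1,u_2v_2,\ldots,u_rv_r,u_{r+1},\ldots,u_q,u_{q+1}v_1v_2\cdots v_r)$; (iii) $I=(v_1v_2,v_1v_3,v_2v_3,u_4,\ldots,u_{q+1})$; (iv) $I=(u_1v_1v_2,v_1v_3,v_2v_3,u_4,\ldots,u_{q+1})$; (v) $I=(u_1v_1v_2,u_2v_1v_3,v_2v_3,u_4,\ldots,u_{q+1})$; (vi) $I=(u_1v_1v_2,u_2v_1v_3,u_3v_2v_3,u_4,\ldots,u_{q+1})$. Then the following statements hold: (a) if $I$ has form (i), then $\beta_i(R/I)=\binom{q+1}{i}$ for $i=0,1,\ldots,r-1$ and $\beta_i(R/I)=\binom{q+1}{q+1-i}-\binom{q+1-r}{q+1-i}$ for $i=r,r+1,\ldots,q$; (b) if $I$ has form (ii) or (vi), then $\beta_i(R/I)=\binom{q+1}{i}$ for $i=0,1,\ldots,q$; (c) if $I$ has form (iii), (iv) or (v), then $\beta_i(R/I)=\binom{q+1}{i}-\binom{q-1}{i-2}$ for $i=0,1,\ldots,q$.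
   Context: $K$ is a field and $R=K[x_1,\ldots,x_n]$ is the polynomial ring. For a monomial ideal $I$ of $R$, $G(I)$ denotes its unique minimal set of monomial generators. $I$ is an almost complete intersection if $\operatorname{height}(I)=|G(I)|-1$. $\beta_i(R/I)$ denotes the $i$-th (total) Betti number, i.e. the rank of the $i$-th free module in the minimal graded free resolution of $R/I$ over $R$. Binomial coefficients $\binom{a}{b}$ with $b<0$ are $0$. Index ranges such as $u_{r+1},\ldots,u_q$ (when $r=q$) or $u_4,\ldots,u_{q+1}$ (when $q=2$) may be empty. *)

(* Defs.v *)
From HB Require Import structures.
From mathcomp Require Import all_boot all_order all_algebra.
From mathcomp Require Export mpoly.
From Stdlib Require Import ClassicalEpsilon.

Set Implicit Arguments.
Unset Strict Implicit.
Unset Printing Implicit Defensive.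

Import GRing.Theory.
Local Open Scope ring_scope.

Section Ideals.
Variable R : comNzRingType.
Implicit Types (I P : R -> Prop) (s : seq R).

Definition ideal_gen s (p : R) : Prop :=
  exists c : 'I_(size s) -> R, p = \sum_i c i * s`_i.

Definition generates s I : Prop := forall p, I p <-> ideal_gen s p.

Definition is_ideal I : Prop :=
  [/\ I 0, (forall x y, I x -> I y -> I (x + y)) & forall a x, I x -> I (a * x)].

Definition prime_ideal P : Prop :=
  [/\ is_ideal P, ~ P 1 & forall x y, P (x * y) -> P x \/ P y].

Definition subideal I P : Prop := forall x, I x -> P x.

Definition proper_subideal I P : Prop := subideal I P /\ ~ subideal P I.

(* A strict chain c 0 < c 1 < ... < c l = P of prime ideals. *)
Definition prime_chain P (l : nat) : Prop :=
  exists c : nat -> R -> Prop,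
    [/\ forall i, (i <= l)%N -> prime_ideal (c i),
        forall i, (i < l)%N -> proper_subideal (c i) (c i.+1)
      & forall x, c l x <-> P x].

Definition prime_height P (h : nat) : Prop :=
  prime_chain P h /\ forall l, prime_chain P l -> (l <= h)%N.

(* A prime of infinite height has no [prime_height], so it does not affect
   the minimum below. *)
Definition height I (h : nat) : Prop :=
  (exists P, [/\ prime_ideal P, subideal I P & prime_height P h]) /\
  (forall P h', prime_ideal P -> subideal I P -> prime_height P h' ->
     (h <= h')%N).

End Ideals.

Section MonomialIdeals.
Variables (K : fieldType) (n : nat).
Local Notation R := {mpoly K[n]}.
Implicit Types (I : R -> Prop) (G : seq 'X_{1..n}) (m : 'X_{1..n}).

Definition monomials G : seq R := [seq 'X_[m] | m <- G].

Definition squarefree m : bool := [forall i, (m i <= 1)%N].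

Definition no_common_factor m m' : bool :=
  [forall i, (m i == 0%N) || (m' i == 0%N)].

Definition squarefree_monomial_ideal I : Prop :=
  exists2 G, all squarefree G & generates (monomials G) I.

(* G lists, without repetition, the minimal set G(I) of monomial generators. *)
Definition minimal_monomial_generators G I : Prop :=
  [/\ uniq G, generates (monomials G) I
    & forall G', {subset G' <= G} -> generates (monomials G') I ->
        {subset G <= G'}].

(* height I = |G(I)| - 1, the subtraction being that of integers. *)
Definition almost_complete_intersection I : Prop :=
  exists G h,
    [/\ minimal_monomial_generators G I, height I h & size G = h.+1].

End MonomialIdeals.

(* F_i = R^(rk i), viewed as row vectors, so that d_{i+1} : F_{i+1} -> F_i is
   v |-> v *m dif i.  The augmentation F_0 -> R/I is given by representatives
   in R of the images of the basis elements: it is v |-> v *m aug mod I. *)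
Record free_complex (R : comNzRingType) := FreeComplex {
  rk : nat -> nat;
  dif : forall i, 'M[R]_(rk i.+1, rk i);
  aug : 'cV[R]_(rk 0%N)
}.

Section Betti.
Variables (K : fieldType) (n : nat).
Local Notation R := {mpoly K[n]}.
Implicit Types (I : R -> Prop) (F : free_complex R).

(* ... -> F_1 -> F_0 -> R/I -> 0 is exact. *)
Definition resolves F I : Prop :=
  [/\ forall p : R, exists v : 'rV_(rk F 0%N), I (p - (v *m aug F) 0 0),
      forall v : 'rV_(rk F 0%N),
        I ((v *m aug F) 0 0) <-> exists w, v = w *m dif F 0%N
    & forall i (v : 'rV_(rk F i.+1)),
        v *m dif F i = 0 <-> exists w, v = w *m dif F i.+1].

Definition homogeneous_of_degree (e : int) (p : R) : Prop :=
  match e with Posz d => p \is d.-homog | Negz _ => p = 0 end.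

(* The j-th basis element of F_i can be given a degree a i j so that all maps
   are homogeneous of degree 0 for the standard grading of R. *)
Definition graded F : Prop :=
  exists a : forall i, 'I_(rk F i) -> int,
    (forall j, homogeneous_of_degree (a 0%N j) (aug F j 0)) /\
    (forall i j k,
       homogeneous_of_degree (a i.+1 j - a i k) (dif F i j k)).

Definition irrelevant_ideal : R -> Prop := ideal_gen [seq 'X_i | i <- enum 'I_n].

(* The image of F_{i+1} lies in (x_1, ..., x_n) F_i. *)
Definition minimal F : Prop :=
  forall i j k, irrelevant_ideal (dif F i j k).

Definition minimal_graded_free_resolution F I : Prop :=
  [/\ resolves F I, graded F & minimal F].

(* A minimal graded free resolution exists and its ranks are unique for every
   homogeneous I; for other I the value is meaningless. *)
Definition betti I (i : nat) : nat :=
  epsilon (inhabits 0%N)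
    (fun b => exists2 F, minimal_graded_free_resolution F I & rk F i = b).

End Betti.

Section Forms.
Variables (K : fieldType) (n : nat).
Local Notation R := {mpoly K[n]}.
Implicit Types (I : R -> Prop) (q r : nat).

Definition admissible (s : seq 'X_{1..n}) : bool :=
  all (fun m => squarefree m && (m != 0%MM)) s && pairwise (@no_common_factor n) s.

(* In what follows only the values of u and v that are listed in [admissible]
   matter; [index_iota a b] is a, ..., b - 1 (empty if b <= a). *)

Definition form_i I q r : Prop :=
  exists u v : nat -> 'X_{1..n},
    admissible (map u (index_iota 1 q.+1) ++ map v (index_iota 1 r.+1)) /\
    generates ([seq 'X_[u i] * 'X_[v i] | i <- index_iota 1 r.+1]
               ++ [seq 'X_[u i] | i <- index_iota r.+1 q.+1]
               ++ [:: \prod_(1 <= i < r.+1) 'X_[v i]]) I.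

Definition form_ii I q r : Prop :=
  exists u v : nat -> 'X_{1..n},
    admissible (map u (index_iota 1 q.+2) ++ map v (index_iota 1 r.+1)) /\
    generates ([seq 'X_[u i] * 'X_[v i] | i <- index_iota 1 r.+1]
               ++ [seq 'X_[u i] | i <- index_iota r.+1 q.+1]
               ++ [:: 'X_[u q.+1] * \prod_(1 <= i < r.+1) 'X_[v i]]) I.

Definition form_iii I q : Prop :=
  exists u v : nat -> 'X_{1..n},
    admissible ([:: v 1%N; v 2%N; v 3%N] ++ map u (index_iota 4 q.+2)) /\
    generates ([:: 'X_[v 1%N] * 'X_[v 2%N]; 'X_[v 1%N] * 'X_[v 3%N];
                   'X_[v 2%N] * 'X_[v 3%N]]
               ++ [seq 'X_[u i] | i <- index_iota 4 q.+2]) I.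

Definition form_iv I q : Prop :=
  exists u v : nat -> 'X_{1..n},
    admissible ([:: u 1%N; v 1%N; v 2%N; v 3%N] ++ map u (index_iota 4 q.+2)) /\
    generates ([:: 'X_[u 1%N] * 'X_[v 1%N] * 'X_[v 2%N]; 'X_[v 1%N] * 'X_[v 3%N];
                   'X_[v 2%N] * 'X_[v 3%N]]
               ++ [seq 'X_[u i] | i <- index_iota 4 q.+2]) I.

Definition form_v I q : Prop :=
  exists u v : nat -> 'X_{1..n},
    admissible ([:: u 1%N; u 2%N; v 1%N; v 2%N; v 3%N] ++ map u (index_iota 4 q.+2)) /\
    generates ([:: 'X_[u 1%N] * 'X_[v 1%N] * 'X_[v 2%N];
                   'X_[u 2%N] * 'X_[v 1%N] * 'X_[v 3%N];
                   'X_[v 2%N] * 'X_[v 3%N]]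
               ++ [seq 'X_[u i] | i <- index_iota 4 q.+2]) I.

Definition form_vi I q : Prop :=
  exists u v : nat -> 'X_{1..n},
    admissible ([:: u 1%N; u 2%N; u 3%N; v 1%N; v 2%N; v 3%N]
                ++ map u (index_iota 4 q.+2)) /\
    generates ([:: 'X_[u 1%N] * 'X_[v 1%N] * 'X_[v 2%N];
                   'X_[u 2%N] * 'X_[v 1%N] * 'X_[v 3%N];
                   'X_[u 3%N] * 'X_[v 2%N] * 'X_[v 3%N]]
               ++ [seq 'X_[u i] | i <- index_iota 4 q.+2]) I.

End Forms.

(* The value is 0 for b < 0; it takes an integer lower index so that no
   truncated subtraction occurs. *)
Definition binomialz (a : nat) (b : int) : int :=
  match b with Posz k => ('C(a, k))%:Z | Negz _ => 0 end.

(* Main.v *)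
From HB Require Import structures.
Require Import Defs.
From mathcomp Require Import all_boot all_order all_algebra.
From mathcomp Require Import ring zify.
From Stdlib Require Import ClassicalEpsilon.

Set Implicit Arguments.
Unset Strict Implicit.
Unset Printing Implicit Defensive.

Import GRing.Theory.
Local Open Scope ring_scope.

(** The Betti numbers of a monomial ideal built one generator at a time can be
    read off from colon ideals.  Write P_I(t) for the generating function of
    the Betti numbers of R/I.  If I = L + (m) and J = L : m, then there is an
    exact sequence
        0 -> R/J --m--> R/L -> R/I -> 0,
    so that the mapping cone of a lift of multiplication by m from a
    resolution of R/J to one of R/L resolves R/I.  The cone of two minimal
    resolutions is minimal when the lift has all its entries in the irrelevant
    ideal, and there is a simple sufficient condition: m = u v with u <> 1
    and v J already contained in L.  Then multiplication by v lifts to a chain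
    map, and u times this lift is the wanted one.  In that case
        P_I = P_L + t P_J,
    which is [poincare_cone].  In the code monomials are given by their
    exponents, so that a product u v reads u + v and the monomial 1 reads 0.

    All six forms are reached in this way.
    - If u <> 1 is coprime to the generators of L then J = L, hence a factor
      1 + t ([poincare_regular]); this accounts for all generators u_i that
      stand alone.
    - The ideals A(s, w) = (u_i v_i for i in s, w prod_(i in s) v_i) cover
      (i), with w = 1, and (ii), with w = u_(q+1).  Removing the generator
      u_i v_i leaves L = A(s - i, v_i w), with colon ideal J = A(s - i, w),
      and v_i J is contained in L.  Induction ([poincare_paired]) gives
      P = (1 + t)^(|s|+1) if w <> 1, and when w = 1 the additional term
      - t^|s| (1 + t), which comes from A(empty, 1) = R and its zero
      resolution.
    - The three generators on v_1 v_2, v_1 v_3, v_2 v_3 of (iii)-(vi) take two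
      cones.  The result is (1 + t)^3 if each has a factor of its own, as in
      (vi), and (1 + t)^3 - t^2 (1 + t) if one of them is just a product of
      two v's ([poincare_triangle], [poincare_triangle_edge]).

    That these resolutions compute [betti] requires the ranks of a minimal
    resolution to be unique: chain maps between two minimal resolutions of
    R/I, composed, are homotopic to the identity, and since all differentials
    vanish at the origin the composite evaluated there is the identity matrix
    ([minimal_resolution_rank]). *)

(** * Chain maps between resolutions *)

Section Resolutions.
Variables (K : fieldType) (n : nat).
Local Notation R := {mpoly K[n]}.
Implicit Types (I J L : R -> Prop) (F G : free_complex R).

Lemma ideal_gen_is_ideal (s : seq R) : is_ideal (ideal_gen s).
Proof.
split.
- by exists (fun=> 0); rewrite big1 // => i _; rewrite mul0r.
- move=> x y [c ->] [d ->]; exists (fun i => c i + d i).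
  by rewrite -big_split; apply: eq_bigr => i _; rewrite mulrDl.
- move=> a x [c ->]; exists (fun i => a * c i).
  by rewrite mulr_sumr; apply: eq_bigr => i _; rewrite mulrA.
Qed.

Lemma idealB I x y : is_ideal I -> I x -> I y -> I (x - y).
Proof. by case=> _ ID IM Ix Iy; apply: ID => //; rewrite -mulN1r; apply: IM. Qed.

Lemma ideal_mulmx I m (A : 'M[R]_(m, 1)) (w : 'rV_m) j k :
  is_ideal I -> (forall i, I (A i 0)) -> I ((w *m A) j k).
Proof.
case=> I0 ID IM IA; rewrite (ord1 k) mxE; elim/big_rec: _ => // i x _ Ix.
by apply: ID => //; apply: IM; apply: IA.
Qed.

Lemma mulmx_entry m k p (A : 'M[R]_(m, k)) (B : 'M_(k, p)) i j :
  (A *m B) i j = (row i A *m B) 0 j.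
Proof. by rewrite -row_mul [RHS]mxE. Qed.

Lemma resolves_iff F I J : (forall p, I p <-> J p) -> resolves F I -> resolves F J.
Proof.
move=> IJ [surj ex0 ex]; split=> // [p | v].
  by have [v /IJ] := surj p; exists v.
by rewrite -IJ; apply: ex0.
Qed.

Lemma factor_rows m p k (A : 'M[R]_(m, p)) (D : 'M[R]_(k, p)) :
  (forall i, exists w, row i A = w *m D) -> exists W, A = W *m D.
Proof.
move=> /fin_all_exists[w Aw]; exists (\matrix_i w i).
by apply/row_matrixP => i; rewrite row_mul rowK.
Qed.

Lemma resolves_exact F I i m (A : 'M_(m, rk F i.+1)) :
  resolves F I -> A *m dif F i = 0 -> exists W, A = W *m dif F i.+1.
Proof.
case=> _ _ ex Ad0; apply: factor_rows => j; apply/ex.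
by rewrite -row_mul Ad0 row0.
Qed.

Lemma resolves_exact0 F I m (A : 'M_(m, rk F 0)) :
    resolves F I -> (forall j, I ((A *m aug F) j 0)) ->
  exists W, A = W *m dif F 0.
Proof.
case=> _ ex _ IA; apply: factor_rows => j; apply/ex.
by rewrite -row_mul mxE; apply: IA.
Qed.

Lemma resolves_dif2 F I i : resolves F I -> dif F i.+1 *m dif F i = 0.
Proof.
case=> _ _ ex; apply/row_matrixP => j; rewrite row_mul row0.
by apply/ex; exists (delta_mx 0 j); rewrite rowE.
Qed.

Lemma resolves_aug_dif F I j : resolves F I -> I ((dif F 0 *m aug F) j 0).
Proof.
case=> _ ex _; rewrite mulmx_entry; apply/ex.
by exists (delta_mx 0 j); rewrite rowE.
Qed.

(** A chain map from F to G covering multiplication by v from the module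
    resolved by F to R/L. *)
Definition lifts_mul (v : R) L F G (phi : forall i, 'M[R]_(rk F i, rk G i)) :=
  (forall j, L ((v *: aug F - phi 0 *m aug G) j 0)) /\
  (forall i, phi i.+1 *m dif G i = dif F i *m phi i).

(** The comparison theorem: the components are found one after the other,
    because F is free and G is exact. *)
Theorem comparison (v : R) J L F G :
    is_ideal L -> (forall p, J p -> L (v * p)) -> resolves F J -> resolves G L ->
  exists phi, lifts_mul v L (F := F) (G := G) phi.
Proof.
move=> idL vJL resF resG.
have [phi0 phi0P] : exists phi0 : 'M_(rk F 0, rk G 0),
    forall j, L ((v *: aug F - phi0 *m aug G) j 0).
  have exw : forall j : 'I_(rk F 0),
      exists w : 'rV_(rk G 0), L ((v *: aug F) j 0 - (w *m aug G) 0 0).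
    by move=> j; case: resG => surj _ _; apply: surj.
  have [w wP] := fin_all_exists exw.
  exists (\matrix_j w j) => j.
  by rewrite mxE [X in _ + X]mxE mulmx_entry rowK; apply: wP.
pose next i (A : 'M_(rk F i, rk G i)) (B : 'M_(rk F i.+1, rk G i.+1)) :=
  B *m dif G i = dif F i *m A.
pose phi := nat_rect (fun i => 'M_(rk F i, rk G i)) phi0
  (fun i A => epsilon (inhabits 0) (next i A)).
exists phi; split=> //; rewrite -/phi.
(* The choice made at each step is sound as soon as a solution exists, and
   existence at step i + 1 uses that the choice at step i was sound. *)
suff exn i : exists B, next i (phi i) B.
  by move=> i; apply: (epsilon_spec (inhabits 0) _ (exn i)).
rewrite /next; elim: i => [|i [B IH]].
  have [|B ->] := @resolves_exact0 G L _ (dif F 0 *m phi 0) resG; last by exists B.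
  move=> j; rewrite -mulmxA.
  have -> : phi 0 *m aug G = v *: aug F - (v *: aug F - phi 0 *m aug G).
    by rewrite subKr.
  rewrite mulmxBr -scalemxAr mxE [X in L (_ + X)]mxE; apply: idealB => //.
    by rewrite mxE; apply: vJL; apply: resolves_aug_dif.
  by rewrite mulmx_entry; apply: ideal_mulmx.
have phiS : next i (phi i) (phi i.+1).
  by apply: (epsilon_spec (inhabits 0) (next i (phi i))); exists B.
have [|C ->] := @resolves_exact G L i _ (dif F i.+1 *m phi i.+1) resG.
  by rewrite -mulmxA phiS mulmxA (resolves_dif2 _ resF) mul0mx.
by exists C.
Qed.

(** * Uniqueness of the ranks of a minimal resolution *)

Local Notation ev0 := (mcoeff 0%MM).

Lemma irrelevant_ev0 (p : R) : irrelevant_ideal p -> ev0 p = 0.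
Proof.
case=> c ->; rewrite raddf_sum big1 // => i _ /=.
have /mapP[j _ ->] := mem_nth 0 (ltn_ord i).
by rewrite rmorphM /= mcoeffX mnm1_eq0 mulr0.
Qed.

Lemma minimal_dif_ev0 F i : minimal F -> map_mx ev0 (dif F i) = 0.
Proof. by move=> minF; apply/matrixP => j k; rewrite !mxE irrelevant_ev0. Qed.

(** A chain map lifting the identity is homotopic to the identity,
    f_i - 1 = d_(i-1) h_(i-1) + h_i d_i, and both terms on the right vanish at
    the origin when F is minimal. *)
Lemma self_lift_ev0 I F (f : forall i, 'M_(rk F i)) :
    is_ideal I -> resolves F I -> minimal F -> lifts_mul 1 I (F := F) (G := F) f ->
  forall i, map_mx ev0 (f i) = 1%:M.
Proof.
move=> idI resF minF [f0 fS].
have idE i (h : 'M_(rk F i, rk F i.+1)) (g : 'M_(rk F i)) :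
    f i - 1%:M - g = h *m dif F i -> map_mx ev0 g = 0 -> map_mx ev0 (f i) = 1%:M.
  move=> fi g0; rewrite -[f i](subrK 1%:M) -[f i - _](subrK g) fi.
  by rewrite !map_mxD map_mxM minimal_dif_ev0 // mulmx0 g0 !add0r map_mx1.
(* The induction only needs a shadow of the homotopy: h_(i-1) enters through
   d_(i-1) h_(i-1), which d_i kills, so it suffices to carry the equation
   d_i (f_i - 1 - h_i d_i) = 0. *)
suff main i : exists2 h : 'M_(rk F i, rk F i.+1),
    dif F i *m (f i - 1%:M - h *m dif F i) = 0 & map_mx ev0 (f i) = 1%:M.
  by move=> i; case: (main i).
elim: i => [|i [h dg _]].
  have [|h hP] := @resolves_exact0 F I _ (f 0 - 1%:M) resF.
    move=> j; rewrite mulmxBl mul1mx -opprB mxE -mulN1r.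
    by have := f0 j; rewrite scale1r; case: idI => _ _; apply.
  exists h; first by rewrite hP subrr mulmx0.
  by apply: (idE _ h 0); rewrite ?subr0 // map_mx0.
have [|k kP] := @resolves_exact F I i _ (f i.+1 - 1%:M - dif F i *m h) resF.
  by rewrite !mulmxBl fS mul1mx -{2}[dif F i]mulmx1 -mulmxA -!mulmxBr.
exists k; last by apply: idE kP _; rewrite map_mxM minimal_dif_ev0 // mul0mx.
by rewrite -kP subKr mulmxA (resolves_dif2 _ resF) mul0mx.
Qed.

Theorem minimal_resolution_rank I F G i : is_ideal I ->
    resolves F I -> minimal F -> resolves G I -> minimal G ->
  rk F i = rk G i.
Proof.
suff le F1 F2 : is_ideal I -> resolves F1 I -> minimal F1 -> resolves F2 I ->
    (rk F1 i <= rk F2 i)%N.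
  by move=> *; apply/eqP; rewrite eqn_leq !le.
move=> idI res1 min1 res2.
have I1 p : I p -> I (1 * p) by rewrite mul1r.
have [f [f0 fS]] := comparison idI I1 res1 res2.
have [g [g0 gS]] := comparison idI I1 res2 res1.
have /(_ i) : forall j, map_mx ev0 (f j *m g j) = 1%:M.
  apply: (self_lift_ev0 (I := I)) => //; split=> [j|j]; last first.
    by rewrite -mulmxA gS !mulmxA fS.
  have -> : 1 *: aug F1 - f 0 *m g 0 *m aug F1
      = (1 *: aug F1 - f 0 *m aug F2) + f 0 *m (1 *: aug F2 - g 0 *m aug F1).
    by rewrite mulmxBr !scale1r mulmxA addrA subrK.
  rewrite mxE [X in _ + X]mulmx_entry; case: (idI) => _ ID _.
  by apply: ID => //; apply: ideal_mulmx.
(* An identity matrix that factors through rank F2 i has at most that size. *)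
rewrite map_mxM => fg1; rewrite -(mxrank1 K (rk F1 i)) -fg1.
exact: leq_trans (mxrankM_maxl _ _) (rank_leq_col _).
Qed.

Lemma bettiE I F i : is_ideal I -> minimal_graded_free_resolution F I ->
  betti I i = rk F i.
Proof.
move=> idI resF.
pose isb b := exists2 F, minimal_graded_free_resolution F I & rk F i = b.
have [|F' [resF' _ minF'] rkF'] := epsilon_spec (inhabits 0%N) isb.
  by exists (rk F i), F.
case: resF => resF _ minF; rewrite /betti -/isb -rkF'.
exact: (minimal_resolution_rank _ idI).
Qed.

End Resolutions.

(** * Mapping cones *)

Section Cone.
Variables (K : fieldType) (n : nat).
Local Notation R := {mpoly K[n]}.
Variables (F G : free_complex R) (phi : forall i, 'M[R]_(rk F i, rk G i)).

Definition cone_rk i := if i is j.+1 then (rk G j.+1 + rk F j)%N else rk G 0.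

Definition cone_dif i : 'M[R]_(cone_rk i.+1, cone_rk i) :=
  match i with
  | 0 => col_mx (dif G 0) (phi 0)
  | j.+1 => block_mx (dif G j.+1) 0 (phi j.+1) (- dif F j)
  end.

Definition cone : free_complex R := @FreeComplex R cone_rk cone_dif (aug G).

(** Exactness of 0 -> R/J --m--> R/L -> R/I -> 0 (the two equivalences) turns
    the resolutions of R/J and R/L into one of R/I; the proof is the diagram
    chase behind the long exact sequence of the cone. *)
Theorem cone_resolves (I J L : R -> Prop) (m : R) :
    is_ideal L -> resolves F J -> resolves G L -> lifts_mul m L phi ->
    (forall p, J p <-> L (m * p)) -> (forall p, I p <-> exists c, L (p - m * c)) ->
  resolves cone I.
Proof.
move=> idL resF resG [phi0 phiS] JL IL.
have [L0 LD LM] := idL.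
have augE (f : 'rV_(rk F 0)) :
    L (m * (f *m aug F) 0 0 - (f *m phi 0 *m aug G) 0 0).
  have := ideal_mulmx f 0 0 idL phi0.
  by rewrite mulmxBr -scalemxAr mulmxA mxE [X in L (X + _)]mxE [X in L (_ + X)]mxE.
have surjG : forall p : R, exists v : 'rV_(rk G 0), L (p - (v *m aug G) 0 0).
  by case: resG.
have surjF : forall p : R, exists v : 'rV_(rk F 0), J (p - (v *m aug F) 0 0).
  by case: resF.
split=> [p | v | i v] /=.
- by have [v Lv] := surjG p; exists v; apply/IL; exists 0; rewrite mulr0 subr0.
- split=> [/IL[c Lc] | [w ->]].
    (* Subtracting the part that comes from F_0 brings v into the kernel of
       the augmentation of G. *)
    have [f /JL Lf] := surjF c.
    have [|g gP] := @resolves_exact0 _ _ G L 1 (v - f *m phi 0) resG.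
      move=> j; rewrite !ord1 mulmxBl mxE [X in _ + X]mxE.
      have := LD _ _ (LD _ _ Lc Lf) (augE f).
      by congr L; ring.
    by exists (row_mx g f); rewrite mul_row_col -gP subrK.
  rewrite -[w]hsubmxK mul_row_col mulmxDl mxE; apply/IL.
  exists ((rsubmx w *m aug F) 0 0).
  have := LD _ _ (ideal_mulmx (lsubmx w) 0 0 idL (fun j => resolves_aug_dif j resG))
             (LM (-1) _ (augE (rsubmx w))).
  by rewrite mulmxA; congr L; ring.
- case: i v => [|i] v /=; rewrite -[v]hsubmxK; move: (lsubmx v) (rsubmx v) => g f.
    split=> [| [w]].
      rewrite mul_row_col => gf0.
      have [|w fw] := @resolves_exact0 _ _ F J 1 f resF.
        move=> j; rewrite !ord1; apply/JL.
        have /(congr1 (fun A => (A *m aug G) 0 0)) := gf0.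
        rewrite mul0mx mulmxDl mxE [RHS]mxE => gfE.
        have := LD _ _ (augE f)
          (LM (-1) _ (ideal_mulmx g 0 0 idL (fun j => resolves_aug_dif j resG))).
        by rewrite mulmxA -[X in L X -> _]addr0 -gfE; congr L; ring.
      have [|z gz] := @resolves_exact _ _ G L 0 _ (g + w *m phi 1) resG.
        by rewrite mulmxDl -mulmxA phiS mulmxA -fw.
      (* The sign cancels the one in the lower right block of the cone. *)
      exists (row_mx z (- w)); rewrite mul_row_block mulmx0 add0r !mulNmx mulmxN opprK.
      by rewrite -fw -gz addrK.
    rewrite -[w]hsubmxK mul_row_block => /eq_row_mx[-> ->].
    rewrite mul_row_col mulmx0 add0r mulmxDl -!mulmxA (resolves_dif2 _ resG).
    by rewrite phiS mulmx0 add0r mulNmx mulmxN subrr.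
  split=> [| [w]].
    rewrite mul_row_block mulmx0 add0r -row_mx0 => /eq_row_mx[gf0 /eqP].
    rewrite mulmxN oppr_eq0 => /eqP f0.
    have [w fw] := resolves_exact resF f0.
    have [|z gz] := @resolves_exact _ _ G L i.+1 _ (g + w *m phi i.+2) resG.
      by rewrite mulmxDl -mulmxA phiS mulmxA -fw.
    exists (row_mx z (- w)); rewrite mul_row_block mulmx0 add0r !mulNmx mulmxN opprK.
    by rewrite -fw -gz addrK.
  rewrite -[w]hsubmxK mul_row_block => /eq_row_mx[-> ->].
  rewrite mul_row_block mulmx0 !add0r mulmxDl -!mulmxA (resolves_dif2 _ resG).
  rewrite phiS !mulmx0 !add0r !mulNmx !mulmxN opprK (resolves_dif2 _ resF).
  by rewrite mulmx0 subrr row_mx0.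
Qed.

Lemma cone_minimal :
    minimal F -> minimal G -> (forall i j k, irrelevant_ideal (phi i j k)) ->
  minimal cone.
Proof.
have [i0 _ iM] := ideal_gen_is_ideal [seq 'X_i : R | i <- enum 'I_n].
move=> minF minG minphi [|i] /= j k; rewrite mxE.
  by case: splitP => l _; rewrite ?mxE; [apply: minG | apply: minphi].
case: splitP => l _; rewrite mxE; case: splitP => l' _.
- exact: minG.
- by rewrite mxE.
- exact: minphi.
- by rewrite mxE -mulN1r; apply: iM; apply: minF.
Qed.

End Cone.

(** * Homogeneous lifts *)

Section Homogenisation.
Variables (K : fieldType) (n : nat).
Local Notation R := {mpoly K[n]}.
Implicit Types (p q : R) (d e : int).

(** Indexed by all integers, like the degrees of the basis elements of a
    graded complex. *)
Definition hcomp d p : R := if d is Posz k then pihomog mdeg k p else 0.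

Lemma hcomp_is_zmod_morphism d : zmod_morphism (hcomp d).
Proof. by case: d => k p q /=; rewrite ?subrr // pihomogB. Qed.

HB.instance Definition _ d :=
  GRing.isZmodMorphism.Build R R (hcomp d) (hcomp_is_zmod_morphism d).

Lemma homogeneous0 d : homogeneous_of_degree d (0 : R).
Proof. by case: d => k //=; apply: dhomog0. Qed.

Lemma homogeneousN d p : homogeneous_of_degree d p -> homogeneous_of_degree d (- p).
Proof. by case: d => k /=; [rewrite dhomogN | move=> ->; rewrite oppr0]. Qed.

Lemma homogeneousX m : homogeneous_of_degree (mdeg m)%:Z ('X_[m] : R).
Proof. by rewrite /= dhomogX. Qed.

Lemma homogeneousM d e p q : homogeneous_of_degree d p ->
  homogeneous_of_degree e q -> homogeneous_of_degree (d + e) (p * q).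
Proof.
case: d => d; last by move=> -> _; rewrite mul0r; apply: homogeneous0.
case: e => e; last by move=> _ ->; rewrite mulr0; apply: homogeneous0.
exact: dhomogM.
Qed.

Lemma hcomp_homogeneous d p : homogeneous_of_degree d (hcomp d p).
Proof. by case: d => k //=; apply: pihomogP. Qed.

Lemma hcomp_id d p : homogeneous_of_degree d p -> hcomp d p = p.
Proof. by case: d => k /=; [apply: pihomog_dE | move=> ->]. Qed.

Lemma hcomp_ne d e p : homogeneous_of_degree e p -> e != d -> hcomp d p = 0.
Proof.
case: d => d //; case: e => e /=; last by move=> ->; rewrite pihomog0.
by move=> hp ne; apply: pihomog_ne0 hp.
Qed.

(** Multiplication by a homogeneous polynomial shifts degrees, so homogeneous
    components can be taken in the other factor; d - e may be negative, and the
    component is then zero. *)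
Lemma hcompM d e p q : homogeneous_of_degree e q ->
  hcomp d (p * q) = hcomp (d - e) p * q.
Proof.
move=> hq; rewrite {1}[p]mpolyE [in RHS](mpolyE p) mulr_suml !raddf_sum mulr_suml.
apply: eq_bigr => m _ /=.
have hm : homogeneous_of_degree (mdeg m)%:Z (p@_m *: 'X_[m]).
  by rewrite /=; apply: dhomogZ; rewrite dhomogX.
have hmq := homogeneousM hm hq.
have [<-|ne] := eqVneq ((mdeg m)%:Z + e) d.
  by rewrite (hcomp_id hmq) addrK (hcomp_id hm).
rewrite (hcomp_ne hmq ne) (hcomp_ne hm) ?mul0r //.
by apply: contra_neq ne => ->; rewrite subrK.
Qed.

Lemma msupp_hcomp d p : {subset msupp (hcomp d p) <= msupp p}.
Proof.
case: d => k m /=; last by rewrite msupp0.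
rewrite pihomogE => /msupp_sum_le /flatten_mapP[m' ].
by rewrite mem_filter => /andP[_ m'p] /msuppZ_le; rewrite msuppX inE => /eqP ->.
Qed.

Section Matrices.
Variables (s t u : nat) (a : 'I_s -> int) (b : 'I_t -> int) (c : 'I_u -> int).

(** The degree zero part of a matrix, seen as a map between graded free
    modules with generators in degrees a' and b'. *)
Definition hcomp_mx r l (a' : 'I_r -> int) (b' : 'I_l -> int) (A : 'M[R]_(r, l)) :=
  \matrix_(i, j) hcomp (a' i - b' j) (A i j).

Definition homogeneous_mx r l (a' : 'I_r -> int) (b' : 'I_l -> int) (A : 'M[R]_(r, l)) :=
  forall i j, homogeneous_of_degree (a' i - b' j) (A i j).

Lemma hcomp_mxMr (A : 'M_(s, t)) (D : 'M_(t, u)) :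
  homogeneous_mx b c D -> hcomp_mx a c (A *m D) = hcomp_mx a b A *m D.
Proof.
move=> hD; apply/matrixP => i j; rewrite !mxE raddf_sum; apply: eq_bigr => k _ /=.
by rewrite (hcompM _ _ (hD k j)) !mxE; congr (hcomp _ _ * _); ring.
Qed.

Lemma hcomp_mxMl (D : 'M_(s, t)) (A : 'M_(t, u)) :
  homogeneous_mx a b D -> hcomp_mx a c (D *m A) = D *m hcomp_mx b c A.
Proof.
move=> hD; apply/matrixP => i j; rewrite !mxE raddf_sum; apply: eq_bigr => k _ /=.
by rewrite mulrC (hcompM _ _ (hD i k)) mulrC !mxE; congr (_ * hcomp _ _); ring.
Qed.

End Matrices.

(** Lifts can be made homogeneous afterwards: taking degree zero parts commutes
    with composition by the homogeneous differentials, so it preserves every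
    equation that defines a lift. *)
Theorem homogeneous_lift (L : R -> Prop) (F G : free_complex R) phi v e
    (a : forall i, 'I_(rk F i) -> int) (b : forall i, 'I_(rk G i) -> int) :
    (forall d p, L p -> L (hcomp d p)) -> homogeneous_of_degree e v ->
    (forall j, homogeneous_of_degree (a 0%N j) (aug F j 0)) ->
    (forall i, homogeneous_mx (@a i.+1) (@a i) (dif F i)) ->
    (forall j, homogeneous_of_degree (b 0%N j) (aug G j 0)) ->
    (forall i, homogeneous_mx (@b i.+1) (@b i) (dif G i)) ->
    lifts_mul v L (F := F) (G := G) phi ->
  lifts_mul v L (fun i => hcomp_mx (fun j => a i j + e) (@b i) (phi i)).
Proof.
move=> homL hv haF hdF haG hdG [phi0 phiS]; split=> [j|i]; last first.
  rewrite -(hcomp_mxMr _ _ (hdG i)) phiS; apply: hcomp_mxMl => j k.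
  by rewrite opprD addrACA subrr addr0; apply: hdF.
have /(homL (a 0%N j + e)) := phi0 j; congr L.
have haG' : homogeneous_mx (@b 0%N) (fun=> 0) (aug G) by move=> i k; rewrite subr0 ord1.
rewrite -(hcomp_mxMr _ _ haG') [in LHS]mxE [in RHS]mxE raddfD /=; congr (_ + _).
  by rewrite !mxE hcomp_id // addrC; apply: homogeneousM.
by rewrite [in LHS]mxE [in RHS]mxE [in RHS]mxE subr0 raddfN.
Qed.

(** The generators coming from F are shifted by the degree e of the monomial by
    which phi multiplies. *)
Lemma cone_graded (F G : free_complex R) (phi : forall i, 'M[R]_(rk F i, rk G i)) e
    (a : forall i, 'I_(rk F i) -> int) (b : forall i, 'I_(rk G i) -> int) :
    (forall i, homogeneous_mx (@a i.+1) (@a i) (dif F i)) ->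
    (forall j, homogeneous_of_degree (b 0%N j) (aug G j 0)) ->
    (forall i, homogeneous_mx (@b i.+1) (@b i) (dif G i)) ->
    (forall i, homogeneous_mx (fun j => a i j + e) (@b i) (phi i)) ->
  graded (cone phi).
Proof.
move=> ha hb0 hb hphi.
exists (fun i => match i return 'I_(cone_rk F G i) -> int with
  | 0 => @b 0%N
  | i.+1 => fun j => match split j with inl l => b i.+1 l | inr l => a i l + e end
  end); split=> // -[|i] /= j k; rewrite mxE; case: splitP => l _ //; rewrite ?mxE.
all: try exact: hb; try exact: hphi.
all: case: splitP => l' _; rewrite ?mxE.
- exact: hb.
- exact: homogeneous0.
- exact: hphi.
- by rewrite opprD addrACA subrr addr0; apply/homogeneousN/ha.
Qed.

End Homogenisation.

(** * Monomial ideals and their Poincare polynomials *)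

Section MonomialIdealTheory.
Variables (K : fieldType) (n : nat).
Local Notation R := {mpoly K[n]}.
Implicit Types (G I J L : seq 'X_{1..n}) (m u v t : 'X_{1..n}) (p : R).

(** The monomials of the ideal generated by G.  A monomial ideal is determined
    by them ([mem_monomial_ideal]), which reduces sums and colon ideals to
    divisibility of exponents. *)
Definition divs G t := has (fun g => (g <= t)%MM) G.

Definition monomial_ideal G : R -> Prop := ideal_gen (monomials K G).

Lemma monomial_idealP G : is_ideal (monomial_ideal G).
Proof. exact: ideal_gen_is_ideal. Qed.

Lemma mem_ideal_gen (s : seq R) x : x \in s -> ideal_gen s x.
Proof.
move=> xs; have lt := xs; rewrite -index_mem in lt.
exists (fun i => (i == Ordinal lt)%:R).
rewrite (bigD1 (Ordinal lt)) //= eqxx mul1r nth_index // big1 ?addr0 // => i.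
by move=> /negbTE ->; rewrite mul0r.
Qed.

(** Stated for an arbitrary ideal P since it also serves for sums of ideals
    that are not yet known to be generated by monomials. *)
Lemma ideal_msupp (P : R -> Prop) p : is_ideal P ->
  (forall m, m \in msupp p -> P 'X_[m]) -> P p.
Proof.
case=> P0 PD PM Pm; rewrite [p]mpolyE big_seq.
elim/big_rec: _ => // m x m_p Px; apply: PD => //.
by rewrite -mul_mpolyC; apply/PM/Pm.
Qed.

Lemma divsX G m : divs G m -> monomial_ideal G 'X_[m].
Proof.
case/hasP=> g Gg le_gm; rewrite -(submK le_gm) mpolyXD.
have [_ _ IM] := monomial_idealP G; apply: IM.
exact/mem_ideal_gen/map_f.
Qed.

Lemma mem_monomial_ideal G p :
  monomial_ideal G p <-> (forall m, m \in msupp p -> divs G m).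
Proof.
split=> [[c ->] m | Gp]; last first.
  by apply: (ideal_msupp (monomial_idealP G)) => m /Gp/divsX.
case/msupp_sum_le/flatten_mapP=> i _.
have /mapP[g Gg ->] := mem_nth 0 (ltn_ord i).
rewrite (perm_mem (msuppMX _ _)) => /mapP[m' _ ->].
by apply/hasP; exists g; rewrite ?lem_addr.
Qed.

Lemma monomial_ideal_hcomp G d p : monomial_ideal G p -> monomial_ideal G (hcomp d p).
Proof.
move=> /mem_monomial_ideal Gp; apply/mem_monomial_ideal => m.
by move=> /msupp_hcomp/Gp.
Qed.

Lemma colon_monomial_ideal L J m : (forall t, divs J t = divs L (t + m)%MM) ->
  forall p, monomial_ideal J p <-> monomial_ideal L ('X_[m] * p).
Proof.
move=> JL p; rewrite !mem_monomial_ideal mulrC; split=> Hp t.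
  by rewrite (perm_mem (msuppMX _ _)) => /mapP[t' /Hp + ->]; rewrite JL addmC.
by move=> tp; rewrite JL Hp // (perm_mem (msuppMX _ _)) addmC map_f.
Qed.

Lemma add_monomial_ideal L I m : (forall t, divs I t = divs L t || (m <= t)%MM) ->
  forall p, monomial_ideal I p <-> exists c, monomial_ideal L (p - 'X_[m] * c).
Proof.
move=> IL p; have [I0 ID IM] := monomial_idealP I.
have [L0 LD LM] := monomial_idealP L.
split=> [/mem_monomial_ideal Ip | [c /mem_monomial_ideal Lc]].
  apply: (@ideal_msupp (fun x => exists c, monomial_ideal L (x - 'X_[m] * c))) => [|t tp].
    split=> [|x y [c Lc] [d Ld] | a x [c Lc]].
    - by exists 0; rewrite mulr0 subr0.
    - exists (c + d); have -> : x + y - 'X_[m] * (c + d) =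
        (x - 'X_[m] * c) + (y - 'X_[m] * d) by ring.
      exact: LD.
    - exists (a * c); have -> : a * x - 'X_[m] * (a * c) = a * (x - 'X_[m] * c) by ring.
      exact: LM.
  have := Ip t tp; rewrite IL => /orP[Lt | le_mt].
    by exists 0; rewrite mulr0 subr0; apply: divsX.
  by exists 'X_[t - m]; rewrite -mpolyXD addmC submK // subrr.
rewrite -[p](subrK ('X_[m] * c)); apply: ID.
  by apply/mem_monomial_ideal => t /Lc; rewrite IL => ->.
by rewrite mulrC; apply/IM/divsX; rewrite IL lepm_refl orbT.
Qed.

(** This is where the minimality of the cones comes from. *)
Lemma irrelevantX m p : m != 0%MM -> irrelevant_ideal ('X_[m] * p : R).
Proof.
move=> m0; have [_ _ idM] := ideal_gen_is_ideal [seq 'X_i : R | i <- enum 'I_n].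
have [i mi0] : exists i, m i != 0%N.
  apply/existsP; apply: contraNT m0; rewrite negb_exists => /forallP m0.
  by apply/eqP/mnmP => i; rewrite mnm0E; apply/eqP; rewrite -[_ == _]negbK.
have le_im : (U_(i) <= m)%MM by rewrite lep1mP.
rewrite mulrC -(submK le_im) mpolyXD mulrA; apply: idM.
by apply/mem_ideal_gen/mapP; exists i; rewrite ?mem_enum.
Qed.

End MonomialIdealTheory.

Arguments monomial_ideal K {n} G _.
Arguments monomial_idealP K {n} G.

Section Poincare.
Variables (K : fieldType) (n : nat).
Local Notation R := {mpoly K[n]}.
Implicit Types (G I J L : seq 'X_{1..n}) (m u v t : 'X_{1..n}) (P Q : {poly int}).

(** P is the generating function of the Betti numbers of R/(G).  The
    coefficients are integers so that the closed formulas may use subtraction. *)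
Definition poincare G P :=
  exists2 F, minimal_graded_free_resolution F (monomial_ideal K G)
           & forall i, (rk F i)%:Z = P`_i.

Lemma poincare_betti G P (I : R -> Prop) i :
  generates (monomials K G) I -> poincare G P -> (betti I i)%:Z = P`_i.
Proof.
move=> IG [F [resF grF minF] rkF]; rewrite -rkF; congr Posz; apply: bettiE.
  have [G0 GD GM] := monomial_idealP K G.
  split=> [|x y|a x]; rewrite !IG //; [exact: GD | exact: GM].
by split=> //; apply: resolves_iff resF => p; rewrite IG.
Qed.

Lemma poincare_eq G G' P : divs G =1 divs G' -> poincare G P -> poincare G' P.
Proof.
move=> GG' [F [resF grF minF] rkF]; exists F => //; split=> //.
apply: resolves_iff resF => p; rewrite !mem_monomial_ideal.
by split=> Gp m /Gp; rewrite GG'.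
Qed.

(** The basic step, with J = L : (u v) and I = L + (u v).  Since v J is
    contained in L, multiplication by v has a lift, and u times this lift
    covers multiplication by u v with entries divisible by u, hence in the
    irrelevant ideal: the cone is minimal. *)
Theorem poincare_cone L J I u v P Q : u != 0%MM ->
    (forall t, divs J t = divs L (t + (u + v))%MM) ->
    (forall t, divs J t -> divs L (t + v)%MM) ->
    (forall t, divs I t = divs L t || (u + v <= t)%MM) ->
  poincare L P -> poincare J Q -> poincare I (P + 'X * Q).
Proof.
move=> u0 JL vJL IL [G [resG [b [hb0 hb]] minG] rkG] [F [resF [a [ha0 ha]] minF] rkF].
have vJ p : monomial_ideal K J p -> monomial_ideal K L ('X_[v] * p).
  rewrite !mem_monomial_ideal mulrC => Jp t.
  by rewrite (perm_mem (msuppMX _ _)) => /mapP[t' /Jp/vJL + ->]; rewrite addmC.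
have [phi0 lift0] := comparison (monomial_idealP K L) vJ resF resG.
have lift := homogeneous_lift (@monomial_ideal_hcomp K n L) (homogeneousX K v)
  ha0 ha hb0 hb lift0.
set phi := (fun i => hcomp_mx _ _ _) in lift.
pose psi i := 'X_[u] *: phi i.
have hpsi i : homogeneous_mx (fun j => a i j + (mdeg (u + v)%MM)%:Z) (@b i) (psi i).
  move=> j k; rewrite mxE mdegD PoszD.
  have -> : a i j + ((mdeg u)%:Z + (mdeg v)%:Z) - b i k =
    (mdeg u)%:Z + (a i j + (mdeg v)%:Z - b i k) by ring.
  by apply: homogeneousM (homogeneousX K u) _; rewrite mxE; apply: hcomp_homogeneous.
have liftX : lifts_mul 'X_[u + v] (monomial_ideal K L) psi.
  have [_ _ LM] := monomial_idealP K L.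
  case: lift => lift0' liftS; split=> [j|i].
    rewrite mpolyXD -scalerA -scalemxAl -scalerBr mxE; exact: LM.
  by rewrite -scalemxAl liftS -scalemxAr.
exists (cone psi).
  split; [|exact: cone_graded ha hb0 hb hpsi|].
    exact: cone_resolves (monomial_idealP K L) resF resG liftX
      (colon_monomial_ideal JL) (add_monomial_ideal IL).
  apply: cone_minimal => // i j k; rewrite mxE; exact: irrelevantX.
case=> [|i] /=; rewrite coefD coefXM ?addr0 //= -?rkG //.
by rewrite PoszD rkG rkF.
Qed.

Lemma poincare_nil : poincare [::] 1.
Proof.
pose F := @FreeComplex R (fun i => (i == 0%N) : nat) (fun i => 0) (const_mx 1).
exists F; last by move=> i; rewrite coef1; case: i.
have [I0 _ _] := monomial_idealP K (Nil 'X_{1..n}).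
split.
- split=> [p | v | i v] /=.
  + by exists (const_mx p); rewrite !mxE big_ord1 !mxE mulr1 subrr.
  + split=> [[c] | [w ->]].
      rewrite big_ord0 mxE big_ord1 mxE mulr1 => v0; exists 0; rewrite mulmx0.
      by apply/rowP => i; rewrite (ord1 i) v0 mxE.
    by rewrite mulmx0 mul0mx mxE.
  + split=> _; last by rewrite mulmx0.
    by exists 0; apply/rowP; case.
- exists (fun _ _ => 0); split=> [j | i j k] /=; first by rewrite mxE dhomog1.
  by rewrite mxE dhomog0.
- by move=> i j k; rewrite mxE; have [] := ideal_gen_is_ideal [seq 'X_i : R | i <- enum 'I_n].
Qed.

(** For the unit ideal R/I = 0, with the zero resolution; it starts the
    induction of [poincare_paired] when w = 1. *)
Lemma poincare_unit : poincare [:: 0%MM] 0.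
Proof.
pose F := @FreeComplex R (fun i => 0%N) (fun i => 0) 0.
have I1 p : monomial_ideal K [:: 0%MM] p.
  by apply/mem_monomial_ideal => m _; rewrite /divs /= orbF; apply/mnm_lepP=> i; rewrite mnm0E.
exists F; last by move=> i; rewrite coef0.
split.
- split=> [p | v | i v] /=; first by exists 0.
  + by split=> // _; exists 0; apply/rowP; case.
  + by split=> _; [exists 0; apply/rowP; case | rewrite mulmx0].
- by exists (fun _ _ => 0); split=> [[] | i []].
- by move=> i [].
Qed.

End Poincare.

(** * Families built from coprime monomials *)

Section Coprime.
Variable n : nat.
Implicit Types a b c t : 'X_{1..n}.
Local Notation cop := (@no_common_factor n).

Lemma cop_sym : symmetric cop.
Proof. by move=> a b; apply/eq_forallb => i; rewrite orbC. Qed.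

Lemma cop0m a : cop 0%MM a.
Proof. by apply/forallP => i; rewrite mnm0E. Qed.

Lemma copm0 a : cop a 0%MM.
Proof. by rewrite cop_sym cop0m. Qed.

Lemma copDm a b c : cop (a + b)%MM c = cop a c && cop b c.
Proof.
apply/forallP/andP => [abc | [/forallP ac /forallP bc] i].
  by split; apply/forallP => i; have := abc i; rewrite mnmDE addn_eq0;
    case: (a i == _); case: (b i == _).
by rewrite mnmDE addn_eq0; have := ac i; have := bc i; case: (c i == _);
  rewrite ?orbT // !orbF => -> ->.
Qed.

Lemma copmD a b c : cop a (b + c)%MM = cop a b && cop a c.
Proof. by rewrite cop_sym copDm !(cop_sym a). Qed.

Lemma lepm_addr_cop a b t : cop a b -> (a <= t + b)%MM = (a <= t)%MM.
Proof.
move=> /forallP ab; apply/mnm_lepP/mnm_lepP => le_at i; have := le_at i.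
  by rewrite mnmDE; case/orP: (ab i) => /eqP ->; rewrite ?addn0.
by rewrite mnmDE => /leq_trans; apply; apply: leq_addr.
Qed.

Lemma lepm_add2r a b t : (a + b <= t + b)%MM = (a <= t)%MM.
Proof.
by apply/mnm_lepP/mnm_lepP => le_at i; have := le_at i; rewrite !mnmDE leq_add2r.
Qed.

Lemma addm_neq0 a b : a != 0%MM -> (a + b)%MM != 0%MM.
Proof.
apply: contra_neq => /mnmP ab0; apply/mnmP => i.
by have := ab0 i; rewrite mnmDE mnm0E; case: (a i).
Qed.

End Coprime.

Ltac mnm_ac := by apply/mnmP => ?; rewrite !mnmDE; ring.

Ltac split_andb :=
  repeat match goal with
  | H : is_true (_ && _) |- _ => case/andP: H => ? ?
  end.

Ltac solve_cop :=
  rewrite ?copDm ?copmD; repeat (apply/andP; split);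
  first [assumption | by rewrite cop_sym].

Section Families.
Variables (K : fieldType) (n : nat).
Implicit Types (G s : seq 'X_{1..n}) (a b c t w x y z : 'X_{1..n}) (P Q : {poly int}).
Local Notation cop := (@no_common_factor n).
Local Notation poincare := (poincare K).

(** A monomial coprime to G is a nonzerodivisor modulo (G), so that
    (G) : a = (G); this is the cone with u = a and v = 1. *)
Lemma poincare_regular G P a : a != 0%MM -> all (cop a) G ->
  poincare G P -> poincare (a :: G) (P * (1 + 'X)).
Proof.
move=> a0 /allP aG GP; have -> : P * (1 + 'X) = P + 'X * P by ring.
apply: (@poincare_cone _ _ G G (a :: G) a 0%MM) => // t.
- apply: eq_in_has => g gG; rewrite addm0 lepm_addr_cop // cop_sym; exact: aG.
- by rewrite addm0.
- by rewrite /divs /= addm0 orbC.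
Qed.

Lemma poincare_regular_seq G P s : all (predC1 0%MM) s -> pairwise cop s ->
  allrel cop s G -> poincare G P -> poincare (s ++ G) (P * (1 + 'X) ^+ size s).
Proof.
move=> + + + GP; elim: s => [|a s IH] /=; first by rewrite expr0 mulr1.
move=> /andP[a0 s0] /andP[a_s prw]; rewrite allrel_consl => /andP[aG sG].
rewrite exprSr mulrA; apply: poincare_regular => //; last exact: IH.
by rewrite all_cat a_s.
Qed.

Lemma poincare_principal a : a != 0%MM -> poincare [:: a] (1 + 'X).
Proof.
move=> a0; rewrite -[1 + 'X]mul1r; apply: poincare_regular => //.
exact: poincare_nil.
Qed.

(** Here (a w) : (b w) = (a), and w a is in (a w). *)
Lemma poincare_pair a b w : a != 0%MM -> b != 0%MM -> cop a b ->
  poincare [:: (a + w)%MM; (b + w)%MM] ((1 + 'X) ^+ 2).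
Proof.
move=> a0 b0 ab; have -> : (1 + 'X) ^+ 2 = (1 + 'X) + 'X * (1 + 'X) :> {poly int} by ring.
apply: (@poincare_cone _ _ [:: (a + w)%MM] [:: a] _ b w) => // [t|t|t||].
- by rewrite /divs /= addmA lepm_add2r lepm_addr_cop.
- by rewrite /divs /= lepm_add2r.
- by rewrite /divs /= !orbF.
- exact/poincare_principal/addm_neq0.
- exact: poincare_principal.
Qed.

(** The colon ideal of (a x y, b x z) by c y z is (a x, b x).  Multiplication
    by y z maps it into (a x y, b x z), and the remaining factor c <> 1 makes
    the cone minimal. *)
Lemma poincare_triangle a b c x y z :
    a != 0%MM -> b != 0%MM -> c != 0%MM -> pairwise cop [:: a; b; c; x; y; z] ->
  poincare [:: (a + x + y)%MM; (b + x + z)%MM; (c + y + z)%MM] ((1 + 'X) ^+ 3).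
Proof.
move=> a0 b0 c0 /=; rewrite !andbT => H; split_andb.
have -> : (1 + 'X) ^+ 3 = (1 + 'X) ^+ 2 + 'X * (1 + 'X) ^+ 2 :> {poly int} by ring.
apply: (@poincare_cone _ _ [:: (a + y + x)%MM; (b + z + x)%MM]
          [:: (a + x)%MM; (b + x)%MM] _ c (y + z)%MM) => // [t|t|t||].
- rewrite /divs /= !orbF; congr (_ || _).
    have -> : (a + y + x = (a + x) + y)%MM by mnm_ac.
    have -> : (t + (c + (y + z)) = t + (c + z) + y)%MM by mnm_ac.
    by rewrite lepm_add2r lepm_addr_cop //; solve_cop.
  have -> : (b + z + x = (b + x) + z)%MM by mnm_ac.
  by rewrite !addmA lepm_add2r -addmA lepm_addr_cop //; solve_cop.
- rewrite /divs /= !orbF => /orP[] le_t; apply/orP; [left | right].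
    have -> : (a + y + x = (a + x) + y)%MM by mnm_ac.
    rewrite [(y + z)%MM]addmC addmA lepm_add2r.
    exact: lepm_trans le_t (lem_addr _ _).
  have -> : (b + z + x = (b + x) + z)%MM by mnm_ac.
  by rewrite addmA lepm_add2r; apply: lepm_trans le_t (lem_addr _ _).
- have -> : (a + y + x = a + x + y)%MM by mnm_ac.
  have -> : (b + z + x = b + x + z)%MM by mnm_ac.
  by rewrite /divs /= addmA !orbF orbA.
- by apply: poincare_pair; rewrite ?addm_neq0 //; solve_cop.
- by apply: poincare_pair => //; solve_cop.
Qed.

(** The colon ideal of (x y, b x z) by c y z is now just (x), since x already
    divides b x.  It is mapped into (x y) by c y, which leaves the factor
    z <> 1; so b and c may be equal to 1. *)
Lemma poincare_triangle_edge b c x y z :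
    x != 0%MM -> y != 0%MM -> z != 0%MM -> pairwise cop [:: b; c; x; y; z] ->
  poincare [:: (x + y)%MM; (b + x + z)%MM; (c + y + z)%MM]
    ((1 + 'X) ^+ 3 - 'X^2 * (1 + 'X)).
Proof.
move=> x0 y0 z0 /=; rewrite !andbT => H; split_andb.
have -> : (1 + 'X) ^+ 3 - 'X^2 * (1 + 'X) = (1 + 'X) ^+ 2 + 'X * (1 + 'X) :> {poly int}
  by ring.
apply: (@poincare_cone _ _ [:: (y + x)%MM; (z + b + x)%MM] [:: x] _ z (c + y)%MM)
  => // [t|t|t||].
- rewrite /divs /= !orbF.
  have -> : (t + (z + (c + y)) = t + (z + c) + y)%MM by mnm_ac.
  rewrite [(y + x)%MM]addmC lepm_add2r lepm_addr_cop; last by solve_cop.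
  apply/idP/orP => [|[//|]]; first by left.
  have -> : (t + (z + c) + y = t + (c + y) + z)%MM by mnm_ac.
  have -> : (z + b + x = b + x + z)%MM by mnm_ac.
  rewrite lepm_add2r lepm_addr_cop; last by solve_cop.
  by apply: lepm_trans; apply: lem_addl.
- rewrite /divs /= !orbF => le_t; apply/orP; left.
  rewrite addmA [(y + x)%MM]addmC lepm_add2r.
  exact: lepm_trans le_t (lem_addr _ _).
- have -> : (z + (c + y) = c + y + z)%MM by mnm_ac.
  have -> : (z + b + x = b + x + z)%MM by mnm_ac.
  by rewrite /divs /= [(x + y)%MM]addmC !orbF orbA.
- by apply: poincare_pair; rewrite ?addm_neq0 //; solve_cop.
- exact: poincare_principal.
Qed.

(** The generators of the ideal (u_i v_i for i in s, w prod_(i in s) v_i). *)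
Definition paired_gens (u v : nat -> 'X_{1..n}) (s : seq nat) w :=
  (w + \big[+%MM/0%MM]_(i <- s) v i)%MM :: [seq (u i + v i)%MM | i <- s].

(** Removing the generator u_i v_i leaves the same kind of ideal with v_i w in
    place of w, while the colon ideal by u_i v_i keeps w.  So the induction
    runs over all w at once: for w = 1 the first of these ideals falls under
    the generic case, and the correction is propagated by the second. *)
Lemma poincare_paired (u v : nat -> 'X_{1..n}) (s : seq nat) w :
    all (predC1 0%MM) (map u s ++ map v s) ->
    pairwise cop (map u s) -> pairwise cop (map v s) ->
    allrel cop (map u s) (map v s) -> all (cop w) (map u s ++ map v s) ->
  poincare (paired_gens u v s w)
    ((1 + 'X) ^+ (size s).+1 - (w == 0%MM)%:R * 'X^(size s) * (1 + 'X)).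
Proof.
elim: s w => [|i s IH] w /=.
  move=> _ _ _ _ _; rewrite /paired_gens big_nil addm0 /= expr0 expr1 mulr1.
  have [->|w0] := eqVneq w 0%MM; first by rewrite mul1r subrr; apply: poincare_unit.
  by rewrite mul0r subr0; apply: poincare_principal.
rewrite all_cat /= !all_cat /= => /and4P[u0 us0 v0 vs0].
move=> /andP[uu prw_u] /andP[vv prw_v].
rewrite allrel_consl /= allrel_consr => /andP[/andP[uv ui_v] /andP[u_vi u_v]].
move=> /and4P[wu wus wv wvs].
have vi_us : all (cop (v i)) (map u s) by apply: sub_all u_vi => x; rewrite cop_sym.
have cop_big x : all (cop x) (map v s) -> cop x (\big[+%MM/0%MM]_(j <- s) v j)%MM.
  rewrite all_map => /allP xv; rewrite big_seq; elim/big_rec: _ => [|j y js xy].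
    by rewrite cop_sym cop0m.
  by rewrite copmD xy andbT; apply: xv.
have us0vs0 : all (predC1 0%MM) (map u s ++ map v s) by rewrite all_cat us0.
have vw0 : (v i + w)%MM != 0%MM by apply: addm_neq0.
have {}IH := fun w => IH w us0vs0 prw_u prw_v u_v.
pose e : {poly int} := (w == 0%MM)%:R; rewrite -/e.
have -> : (1 + 'X) ^+ (size s).+2 - e * 'X^((size s).+1) * (1 + 'X)
  = (1 + 'X) ^+ (size s).+1
    + 'X * ((1 + 'X) ^+ (size s).+1 - e * 'X^(size s) * (1 + 'X)).
  by rewrite !exprS; ring.
apply: (@poincare_cone _ _ (paired_gens u v s (v i + w)%MM) (paired_gens u v s w)
  _ (u i) (v i)) => // [t|t|t||].
- rewrite /divs /=; congr (_ || _).
    set V := \big[_/_]_(_ <- _) _; have -> : (v i + w + V = (w + V) + v i)%MM by mnm_ac.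
    rewrite addmA lepm_add2r lepm_addr_cop // copDm wu cop_sym; exact: cop_big.
  rewrite !has_map; apply: eq_in_has => j js /=; rewrite lepm_addr_cop //.
  rewrite copDm !copmD; move/(map_f u): (js); move/(map_f v): (js) => vj uj.
  rewrite !(cop_sym (u j)) !(cop_sym (v j)).
  by rewrite (allP uu _ uj) (allP vi_us _ uj) (allP ui_v _ vj) (allP vv _ vj).
- rewrite /divs /= => /orP[le_wt | /hasP[g Gg le_gt]]; apply/orP; [left | right].
    by rewrite -addmA addmC lepm_add2r.
  by apply/hasP; exists g => //; apply: lepm_trans le_gt _; apply: lem_addr.
- rewrite /divs /= big_cons [(v i + w)%MM]addmC -addmA.
  by rewrite -orbA; congr (_ || _); apply: orbC.
- have := IH (v i + w)%MM; rewrite (negbTE vw0) !mul0r subr0; apply.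
  by rewrite all_cat; apply/andP; split; apply/allP => x xs; rewrite copDm;
    apply/andP; split; apply: (allP _ x xs).
- by apply: IH; rewrite all_cat wus.
Qed.

End Families.

(** * The six forms *)

Section Forms.
Variables (K : fieldType) (n : nat).
Implicit Types (I : {mpoly K[n]} -> Prop) (q r : nat).
Local Notation cop := (@no_common_factor n).

Lemma coef_1DXn k i : (((1 + 'X) ^+ k)`_i : int) = ('C(k, i))%:Z.
Proof.
elim: k i => [|k IH] i; first by rewrite expr0 coef1 bin0n; case: i.
rewrite exprS mulrDl mul1r coefD coefXM IH.
by case: i => [|i] /=; rewrite ?bin0 ?addr0 // IH binS PoszD addrC.
Qed.

Lemma admissible_cat (s1 s2 : seq 'X_{1..n}) :
  admissible (s1 ++ s2) = [&& admissible s1, admissible s2 & allrel cop s1 s2].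
Proof.
rewrite /admissible all_cat pairwise_cat.
by do !case: (all _ _); do !case: (pairwise _ _); case: (allrel _ _ _).
Qed.

Lemma admissible_neq0 (s : seq 'X_{1..n}) : admissible s -> all (predC1 0%MM) s.
Proof. by case/andP=> s0 _; apply: sub_all s0 => m /andP[]. Qed.

Lemma index_iota_cat (i j k : nat) : (i <= j)%N -> (j <= k)%N ->
  index_iota i k = index_iota i j ++ index_iota j k.
Proof.
move=> ij jk; rewrite /index_iota -[in RHS](subnKC ij) -{2}(subnKC ij).
rewrite -iotaD; congr iota; lia.
Qed.

Lemma poincare_paired_regular (u v : nat -> 'X_{1..n}) q r w :
    (r <= q)%N ->
    admissible (map u (index_iota 1 q.+1) ++ map v (index_iota 1 r.+1)) ->
    all (cop w) (map u (index_iota 1 q.+1) ++ map v (index_iota 1 r.+1)) ->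
  poincare K (map u (index_iota r.+1 q.+1) ++ paired_gens u v (index_iota 1 r.+1) w)
    ((1 + 'X) ^+ q.+1 - (w == 0%MM)%:R * 'X^r * (1 + 'X) ^+ (q.+1 - r)).
Proof.
move=> le_rq; rewrite (@index_iota_cat 1 r.+1) //.
set s := index_iota 1 r.+1; set s' := index_iota r.+1 q.+1; rewrite map_cat.
rewrite !admissible_cat allrel_catl => /and3P[/and3P[us us' uu'] vs /andP[uv u'v]].
rewrite !all_cat -andbA => /and3P[wu wu' wv].
have [_ pu] := andP us; have [_ pu'] := andP us'; have [_ pv] := andP vs.
have szs : size s = r by rewrite size_iota subn1.
have szs' : size (map u s') = (q - r)%N by rewrite size_map size_iota subSS.
pose e : {poly int} := (w == 0%MM)%:R; rewrite -/e.
have -> : (1 + 'X) ^+ q.+1 - e * 'X^r * (1 + 'X) ^+ (q.+1 - r)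
  = ((1 + 'X) ^+ (size s).+1 - e * 'X^(size s) * (1 + 'X))
      * (1 + 'X) ^+ size (map u s').
  rewrite szs szs' subSn // mulrBl -exprD.
  have -> : (r.+1 + (q - r) = q.+1)%N by lia.
  by rewrite [_ ^+ (q - r).+1]exprS !mulrA.
apply: poincare_regular_seq => //; first exact: admissible_neq0.
  apply/allrelP => a g as'; rewrite inE => /orP[/eqP-> | /mapP[i si ->]].
    rewrite copmD cop_sym (allP wu') //=; rewrite big_seq.
    elim/big_rec: _ => [|j y sj ay]; first by rewrite cop_sym cop0m.
    rewrite copmD ay andbT; exact: (allrelP u'v) (map_f _ _).
  rewrite copmD cop_sym; apply/andP; split.
    by apply: (allrelP uu') => //; apply: map_f.
  by apply: (allrelP u'v) => //; apply: map_f.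
apply: poincare_paired => //; rewrite all_cat; apply/andP; split=> //.
- exact: admissible_neq0.
- exact: admissible_neq0.
Qed.

Lemma monomials_paired (u v : nat -> 'X_{1..n}) q r w :
  [seq 'X_[u i] * 'X_[v i] | i <- index_iota 1 r.+1]
   ++ [seq 'X_[u i] | i <- index_iota r.+1 q.+1]
   ++ [:: 'X_[w] * \prod_(1 <= i < r.+1) 'X_[v i]]
  = monomials K ([seq (u i + v i)%MM | i <- index_iota 1 r.+1]
      ++ map u (index_iota r.+1 q.+1)
      ++ [:: (w + \big[+%MM/0%MM]_(1 <= i < r.+1) v i)%MM]).
Proof.
rewrite /monomials !map_cat -!map_comp /= mpolyXD.
congr (_ ++ (_ ++ [:: _ * _])).
  by apply: eq_map => i /=; rewrite mpolyXD.
elim/big_rec2: _ => [|i m p _ ->]; first by rewrite mpolyX0.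
by rewrite mpolyXD.
Qed.

(** Form (i) is the case w = 1, and form (ii) the case where w is the further
    monomial u_(q+1). *)
Lemma betti_paired (u v : nat -> 'X_{1..n}) q r w I :
    (r <= q)%N ->
    admissible (map u (index_iota 1 q.+1) ++ map v (index_iota 1 r.+1)) ->
    all (cop w) (map u (index_iota 1 q.+1) ++ map v (index_iota 1 r.+1)) ->
    generates ([seq 'X_[u i] * 'X_[v i] | i <- index_iota 1 r.+1]
               ++ [seq 'X_[u i] | i <- index_iota r.+1 q.+1]
               ++ [:: 'X_[w] * \prod_(1 <= i < r.+1) 'X_[v i]]) I ->
  forall i, (betti I i)%:Z
    = ((1 + 'X) ^+ q.+1 - (w == 0%MM)%:R * 'X^r * (1 + 'X) ^+ (q.+1 - r))`_i.
Proof.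
move=> le_rq adm cw; rewrite monomials_paired => genI i; apply: poincare_betti genI _.
apply: poincare_eq (poincare_paired_regular le_rq adm cw) => t.
by rewrite /divs !has_cat /= orbF orbC -orbA orbCA [X in _ || X]orbC orbA orbC orbA.
Qed.

(** The hypothesis relating B and G says that the monomials of G are composed of
    those of B, so that whatever is coprime to B is coprime to G. *)
Lemma betti_add_regular (s G : seq 'X_{1..n}) (B : seq 'X_{1..n}) P I :
    admissible (B ++ s) ->
    (forall a, all (cop a) B -> all (cop a) G) -> poincare K G P ->
    generates (monomials K (G ++ s)) I ->
  forall i, (betti I i)%:Z = (P * (1 + 'X) ^+ size s)`_i.
Proof.
rewrite admissible_cat => /and3P[_ adm Bs] BG GP genI i.
apply: poincare_betti genI _; apply: (@poincare_eq _ _ (s ++ G)).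
  by move=> t; rewrite /divs !has_cat orbC.
apply: poincare_regular_seq => //; first exact: admissible_neq0.
  by case/andP: adm.
rewrite /allrel; apply/allP => a sa; apply: BG; apply/allP => b Bb.
by rewrite cop_sym; apply: (allrelP Bs).
Qed.

Lemma monomialsX (s : seq nat) (u : nat -> 'X_{1..n}) :
  [seq 'X_[u i] | i <- s] = monomials K (map u s).
Proof. by rewrite /monomials -map_comp. Qed.

(** In each of the three forms some product of two v's occurs without further
    factor; it is taken as x y, and the values of x, y, z below vary
    accordingly. *)
Lemma betti_form_iii_iv_v I q : (2 <= q)%N ->
    form_iii I q \/ form_iv I q \/ form_v I q ->
  forall i, (betti I i)%:Z
    = (((1 + 'X) ^+ 3 - 'X^2 * (1 + 'X)) * (1 + 'X) ^+ (q - 2))`_i.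
Proof.
move=> q2.
have sz (u : nat -> 'X_{1..n}) : (q - 2)%N = size (map u (index_iota 4 q.+2)).
  by rewrite size_map size_iota !subSS.
case=> [|[]] [u [v [adm genI]]]; rewrite (sz u) => i.
- have [] := and3P (etrans (esym (admissible_cat _ _)) adm).
  case/andP=> /= sqf; rewrite !andbT => H _ _; split_andb.
  apply: (@betti_add_regular _ [:: v 1 + v 2; v 1 + v 3; v 2 + v 3]%MM _ _ _ adm).
  + by move=> a /=; rewrite !andbT => H; split_andb; solve_cop.
  + have := @poincare_triangle_edge K n 0%MM 0%MM (v 1%N) (v 2%N) (v 3%N).
    by rewrite !add0m; apply=> //=; rewrite ?(cop0m, copm0, andbT); solve_cop.
  + by move: genI; rewrite monomialsX /monomials map_cat /= !mpolyXD.
- have [] := and3P (etrans (esym (admissible_cat _ _)) adm).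
  case/andP=> /= sqf; rewrite !andbT => H _ _; split_andb.
  apply: (@betti_add_regular _ [:: u 1 + v 1 + v 2; v 1 + v 3; v 2 + v 3]%MM _ _ _ adm).
  + by move=> a /=; rewrite !andbT => H; split_andb; solve_cop.
  + apply: (@poincare_eq _ _ [:: v 1 + v 3; u 1 + v 1 + v 2; 0 + v 3 + v 2]%MM).
      by move=> t; rewrite /divs /= add0m [(v 3 + _)%MM]addmC orbCA.
    by apply: poincare_triangle_edge => //=; rewrite ?(cop0m, copm0, andbT); solve_cop.
  + by move: genI; rewrite monomialsX /monomials map_cat /= !mpolyXD.
- have [] := and3P (etrans (esym (admissible_cat _ _)) adm).
  case/andP=> /= sqf; rewrite !andbT => H _ _; split_andb.
  apply: (@betti_add_regular _
    [:: u 1 + v 1 + v 2; u 2 + v 1 + v 3; v 2 + v 3]%MM _ _ _ adm).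
  + by move=> a /=; rewrite !andbT => H; split_andb; solve_cop.
  + apply: (@poincare_eq _ _ [:: v 2 + v 3; u 1 + v 2 + v 1; u 2 + v 3 + v 1]%MM).
      move=> t; rewrite /divs /= ![(_ + v 1)%MM]addmC !addmA.
      by rewrite ![(v 1 + u _)%MM]addmC !orbF orbC orbA.
    by apply: poincare_triangle_edge => //=; rewrite !andbT; solve_cop.
  + by move: genI; rewrite monomialsX /monomials map_cat /= !mpolyXD.
Qed.

Lemma betti_form_vi I q : (2 <= q)%N -> form_vi I q ->
  forall i, (betti I i)%:Z = ((1 + 'X) ^+ q.+1)`_i.
Proof.
move=> q2 [u [v [adm genI]]] i.
have sz : q.+1 = (3 + size (map u (index_iota 4 q.+2)))%N.
  by rewrite size_map size_iota; lia.
have [] := and3P (etrans (esym (admissible_cat _ _)) adm).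
case/andP=> /= sqf; rewrite !andbT => H _ _; split_andb.
rewrite sz exprD; apply: (@betti_add_regular _
  [:: u 1 + v 1 + v 2; u 2 + v 1 + v 3; u 3 + v 2 + v 3]%MM _ _ _ adm).
- by move=> a /=; rewrite !andbT => H; split_andb; solve_cop.
- by apply: poincare_triangle => //=; rewrite !andbT; solve_cop.
- by move: genI; rewrite monomialsX /monomials map_cat /= !mpolyXD.
Qed.

End Forms.

Theorem theorem1p17 (K : fieldType) (n q : nat) (I : {mpoly K[n]} -> Prop)
    (I_sqfree : squarefree_monomial_ideal I)
    (I_aci : almost_complete_intersection I)
    (I_height : height I q) (q_ge2 : (2 <= q)%N) :
  [/\ (* (a) *)
      forall r, (2 <= r <= q)%N -> form_i I q r ->
        (forall i, (i < r)%N -> (betti I i)%:Z = binomialz q.+1 i) /\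
        (forall i, (r <= i <= q)%N ->
           (betti I i)%:Z =
             binomialz q.+1 (q.+1%:Z - i%:Z)
               - binomialz (q.+1 - r) (q.+1%:Z - i%:Z)),
      (* (b) *)
      (exists2 r, (2 <= r <= q)%N & form_ii I q r) \/ form_vi I q ->
        forall i, (i <= q)%N -> (betti I i)%:Z = binomialz q.+1 i
    & (* (c) *)
      form_iii I q \/ form_iv I q \/ form_v I q ->
        forall i, (i <= q)%N ->
          (betti I i)%:Z = binomialz q.+1 i - binomialz q.-1 (i%:Z - 2)].
Proof.
split.
- move=> r /andP[r2 rq] [u [v [adm genI]]].
  have bI i : (betti I i)%:Z
      = ((1 + 'X) ^+ q.+1 - 'X^r * (1 + 'X) ^+ (q.+1 - r))`_i.
    rewrite (betti_paired (w := 0%MM) rq adm); last by rewrite mpolyX0 mul1r.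
      by rewrite eqxx mul1r.
    by apply/allP => a _; apply: cop0m.
  split=> i ri; rewrite bI coefB coefXnM !coef_1DXn.
    by rewrite ri subr0.
  case/andP: ri => ri iq; rewrite ltnNge ri /= subzn ?(leqW iq) //=.
  rewrite bin_sub ?(leqW iq) //; congr (_ - Posz _).
  rewrite -bin_sub; last by rewrite leq_sub2r // leqW.
  by congr 'C(_, _); lia.
- case=> [[r /andP[r2 rq] [u [v [adm genI]]]] | form6] i iq; last first.
    by rewrite (betti_form_vi q_ge2 form6) coef_1DXn.
  move: adm; rewrite (@index_iota_cat 1 q.+1 q.+2) //.
  rewrite {2}/index_iota subSnn /= map_cat -catA admissible_cat admissible_cat.
  rewrite allrel_catr => /and4P[au /and3P[aw av wv] uw uv].
  have adm : admissible (map u (index_iota 1 q.+1) ++ map v (index_iota 1 r.+1)).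
    by rewrite admissible_cat au av.
  rewrite (betti_paired (w := u q.+1) rq adm _ genI).
    move: (admissible_neq0 aw); rewrite /= andbT => /negbTE ->.
    by rewrite !mul0r subr0 coef_1DXn.
  rewrite all_cat; move: wv; rewrite allrel1l => ->; rewrite andbT.
  by apply/allP => a ua; rewrite cop_sym (allrelP uw) ?mem_head.
- move=> formI i iq; rewrite (betti_form_iii_iv_v q_ge2 formI).
  have -> : ((1 + 'X) ^+ 3 - 'X^2 * (1 + 'X)) * (1 + 'X) ^+ (q - 2)
      = (1 + 'X) ^+ q.+1 - 'X^2 * (1 + 'X) ^+ q.-1 :> {poly int}.
    have -> : q.+1 = (3 + (q - 2))%N by lia.
    have -> : q.-1 = (1 + (q - 2))%N by lia.
    by rewrite !exprD; ring.
  rewrite coefB coefXnM !coef_1DXn.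
  by case: i iq => [|[|i]] _ //=; rewrite subSS subSS subn0.
Qed.
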